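(* Let $V$ be a finite-dimensional real representation of a compact Lie subgroup $K$ of a Lie group $G$, and fix a $K$-equivariant splitting $\mathfrak g=\mathfrak k\oplus\mathfrak q$ with the associated projection $P_0:\mathfrak X(G\times^KV)^G\to\mathfrak X(V)^K$ and map $h:\mathfrak X(G\times^KV)^G\to C^\infty(G\times^KV,\mathfrak g)^G$. Let $X:\mathbb R\to\mathfrak X(G\times^KV)^G$ be a smooth path of equivariant vector fields with the point $[1,0]$ as a relative equilibrium (of every $X_\lambda$), and let $P_0(X):\mathbb R\to\mathfrak X(V)^K$, $P_0(X)_\lambda:=P_0(X_\lambda)$, be the projected path. Then a curve $$\gamma:I\to V\times\mathbb R,\qquad\gamma(\delta)=(\nu(\delta),\lambda(\delta)),$$ is a relative solution curve of $P_0(X)$ starting at $0\in V$ if and only if the curve $$j_*\gamma:I\to(G\times^KV)\times\mathbb R,\qquad j_*\gamma(\delta)=([1,\nu(\delta)],\lambda(\delta)),$$ is a relative solution curve of $X$ starting at $[1,0]\in G\times^KV$. Furthermore, for such curves and $\delta\in I$, a vector $\xi\in\mathfrak k$ is a velocity of the relative equilibrium $\nu(\delta)$ of $P_0(X_{\lambda(\delta)})$ if and only if $$\xi+h\bigl(X_{\lambda(\delta)}\bigr)([1,\nu(\delta)])\in\mathfrak g$$ is a velocity of the relative equilibrium $[1,\nu(\delta)]$ of $X_{\lambda(\delta)}$.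
   Context: For a Lie group $H$ with Lie algebra $\mathfrak h$ acting smoothly on $M$: $\mathfrak X(M)^H$ is the space of $H$-equivariant smooth vector fields; $C^\infty(M,\mathfrak h)^H$ is the space of infinitesimal gauge transformations, i.e. smooth $\psi:M\to\mathfrak h$ with $\psi(a\cdot p)=\mathrm{Ad}(a)\psi(p)$; $\partial(\psi)(p):=\frac{d}{d\tau}|_0\exp(\tau\psi(p))\cdot p$. A point $p$ is a relative equilibrium of $Z\in\mathfrak X(M)^H$ if $Z(p)\in T_p(H\cdot p)$; a velocity of it is $\xi\in\mathfrak h$ with $Z(p)=\frac{d}{d\tau}|_0\exp(\tau\xi)\cdot p$. A path $X:\mathbb R\to\mathfrak X(M)^H$ is smooth if $(\lambda,p)\mapsto X_\lambda(p)$ is smooth. If $m$ is a relative equilibrium of $X_\lambda$ for all $\lambda$, a relative solution curve of $X$ starting at $m$ is a curve $(p,\lambda):I\to M\times\mathbb R$, $I$ an open interval containing $0$, with $(p(0),\lambda(0))=(m,0)$ and $p(\delta)$ a relative equilibrium of $X_{\lambda(\delta)}$ for all $\delta\in I$. $G\times^KV=(G\times V)/K$, where $k\cdot(g,v)=(gk^{-1},k\cdot v)$; elements are $[g,v]$; $G$ acts by $g'\cdot[g,v]=[g'g,v]$; $j:V\to G\times^KV$, $j(v)=[1,v]$. Extension: $E_0:\mathfrak X(V)^K\to\mathfrak X(G\times^KV)^G$, $E_0(Y)([g,v])=g\cdot Tj(Y(v))$. Projection: a $K$-equivariant splitting $\mathfrak g=\mathfrak k\oplus\mathfrak q$ means $\mathfrak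 q$ is an $\mathrm{Ad}(K)$-invariant complement of $\mathfrak k$; $\mathbb P:\mathfrak g\to\mathfrak k$ is the projection along $\mathfrak q$. Let $\varpi:TG\times TV\to T(G\times^KV)$ be the tangent map of the quotient map and identify $TG\cong G\times\mathfrak g$ by left translation. The induced connection $\Phi$ on $G\times^KV\to G/K$ is $\Phi(\varpi((g,\xi),w))=\varpi((g,\mathbb P\xi),w)$. Then $P_0(X)$ is the unique vector field on $V$ with $Tj\circ P_0(X)=\Phi\circ X\circ j$. The map $h$: $h(X)$ is the unique element of $C^\infty(G\times^KV,\mathfrak g)^G$ such that $h(X)([1,v])\in\mathfrak q$ for all $v\in V$ and $X=E_0(P_0(X))+\partial(h(X))$ (it exists). *)

(* Defs.v *)
From HB Require Import structures.
From mathcomp Require Import all_boot all_order all_algebra.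
From mathcomp Require Import generic_quotient.
From mathcomp Require Import all_classical all_reals all_analysis.

Set Implicit Arguments.
Unset Strict Implicit.
Unset Printing Implicit Defensive.

Import Order.TTheory GRing.Theory Num.Theory.
Import numFieldNormedType.Exports.

Local Open Scope classical_set_scope.
Local Open Scope ring_scope.

#[short(type="topGroupType")]
HB.structure Definition TopGroup := {G of Topological G & Group G}.

Section SmoothOn.
Context {R : realType} {E F : normedModType R}.

(* Intended for [U] open; [E] is always finite-dimensional below, so that
   continuity of all iterated directional derivatives is C^k. *)
Fixpoint Ck_on (k : nat) (U : set E) (f : E -> F) : Prop :=
  if k is k'.+1 then
    (forall x, U x -> differentiable f x) /\
    (forall v, Ck_on k' U (fun x => 'd f x v))
  else forall x, U x -> {for x, continuous f}.

Definition smooth_on (U : set E) (f : E -> F) : Prop :=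
  forall k, Ck_on k U f.

End SmoothOn.

Lemma openX (T T' : topologicalType) (A : set T) (B : set T') :
  open A -> open B -> open (A `*` B).
Proof.
move=> oA oB; rewrite openE => -[x y] [/= Ax By]; exists (A, B) => //=.
by split; exact: open_nbhs_nbhs.
Qed.

Lemma continuous_pair_map (S S' T T' : topologicalType) (f : S -> T)
    (f' : S' -> T') x : {for x.1, continuous f} -> {for x.2, continuous f'} ->
  {for x, continuous (fun z => (f z.1, f' z.2))}.
Proof.
case: x => x x' /= cf cf'; apply: cvg_pair => /=.
  by apply: (@cvg_comp _ _ _ fst f _ (nbhs x)); [exact: cvg_fst|exact: cf].
by apply: (@cvg_comp _ _ _ snd f' _ (nbhs x')); [exact: cvg_snd|exact: cf'].
Qed.

Section SmoothOnTheory.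
Context {R : realType}.
Implicit Types E F : normedModType R.

Lemma near_eq_is_diff E F (f g : E -> F) (x : E) :
  {near x, f =1 g} -> differentiable f x ->
  differentiable g x /\ 'd g x = 'd f x :> (E -> F).
Proof.
move=> fg df; have fgx : f x = g x by apply: nbhs_singleton fg.
have eg : g \o shift x = cst (g x) + 'd f x +o_ 0 id.
  apply/eqaddoP => _/posnumP[e].
  have /eqaddoP/(_ e%:num (gt0 _)) := diff_locally df.
  have : \forall y \near (0 : E), f (y + x) = g (y + x).
    move: fg; rewrite (near_shift 0 x); apply: filterS => y /=.
    by rewrite subr0.
  by apply: filterS2 => y /=; rewrite !fctE /= fgx => ->.
have dg : 'd g x = 'd f x :> (E -> F).
  by apply: diff_unique => //; exact: diff_continuous.
split=> //; apply/diff_locallyP; rewrite dg; split=> //.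
exact: diff_continuous.
Qed.

Lemma Ck_on_ext E F k (U : set E) (f g : E -> F) : open U ->
  (forall x, U x -> f x = g x) -> Ck_on k U f -> Ck_on k U g.
Proof.
move=> oU; elim: k f g => [|k IH] f g fg.
  move=> cf x Ux; rewrite /prop_for /continuous_at -(fg x Ux).
  apply: cvg_trans (cf x Ux); apply: near_eq_cvg.
  by apply: (filterS _ (open_nbhs_nbhs (conj oU Ux))) => y /fg.
have near_fg x : U x -> {near x, f =1 g}.
  by move=> Ux; apply: (filterS _ (open_nbhs_nbhs (conj oU Ux))).
move=> [df ddf]; split=> [x Ux|v].
  by case: (near_eq_is_diff (near_fg x Ux) (df x Ux)).
apply: IH (ddf v) => x Ux.
by case: (near_eq_is_diff (near_fg x Ux) (df x Ux)) => _ ->.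
Qed.

Lemma smooth_on_cst E F (U : set E) (a : F) : smooth_on U (fun=> a).
Proof.
move=> k; elim: k a => [|k IH] a; first by move=> x _; exact: cvg_cst.
split=> [x _|v]; first exact: differentiable_cst.
have -> : (fun x : E => 'd (fun=> a) x v) = (fun=> 0 : F).
  by apply/funext => x; rewrite -/(cst a) diff_cst.
exact: IH.
Qed.

Lemma smooth_on_id E (U : set E) : smooth_on U id.
Proof.
case=> [|k]; first by move=> x _; exact: cvg_id.
split=> [x _|v]; first exact: ex_diff.
have -> : (fun x : E => 'd id x v) = (fun=> v).
  by apply/funext => x; rewrite diff_val.
exact: smooth_on_cst.
Qed.

Lemma smooth_on_prod E F E' F' (U : set E) (U' : set E')
    (f : E -> F) (f' : E' -> F') : open U -> open U' ->
  smooth_on U f -> smooth_on U' f' ->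
  smooth_on (U `*` U') (fun x => (f x.1, f' x.2)).
Proof.
move=> oU oU' sf sf' k; move: (sf k) (sf' k) => {sf sf'}.
elim: k f f' => [|k IH] f f'.
  move=> cf cf' x [Ux Ux'].
  by apply: continuous_pair_map; [exact: cf|exact: cf'].
move=> [df ddf] [df' ddf'].
have oUU : open (U `*` U') by exact: openX.
have D z : (U `*` U') z -> is_diff z (fun x : E * E' => (f x.1, f' x.2))
    (fun v : E * E' => ('d f (z.1) v.1, 'd f' (z.2) v.2)).
  case: z => x x' /= [Ux Ux'].
  have dfx := differentiableP (df x Ux).
  have dfx' := differentiableP (df' x' Ux').
  have cfst : continuous (fst : E * E' -> E) by move=> y; exact: cvg_fst.
  have csnd : continuous (snd : E * E' -> E') by move=> y; exact: cvg_snd.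
  have l1 : is_diff (x, x') (fst : E * E' -> E) fst.
    by apply: DiffDef; [exact: linear_differentiable|rewrite diff_lin].
  have l2 : is_diff (x, x') (snd : E * E' -> E') snd.
    by apply: DiffDef; [exact: linear_differentiable|rewrite diff_lin].
  exact: is_diff_pair (is_diff_comp l1 dfx) (is_diff_comp l2 dfx').
split=> [z Uz|v]; first by case: (D z Uz).
apply: (Ck_on_ext oUU _ (IH _ _ (ddf v.1) (ddf' v.2))) => z Uz.
by case: (D z Uz) => _ ->.
Qed.

End SmoothOnTheory.

Record chart (R : realType) (M : topologicalType) (E : normedModType R) := Chart {
  chart_dom : set M;
  chart_cod : set E;
  chart_map :> M -> E;
  chart_inv : E -> M;
  chart_dom_open : open chart_dom;
  chart_cod_open : open chart_cod;
  chart_mapP : forall p, chart_dom p -> chart_cod (chart_map p);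
  chart_invP : forall x, chart_cod x -> chart_dom (chart_inv x);
  chart_mapK : forall p, chart_dom p -> chart_inv (chart_map p) = p;
  chart_invK : forall x, chart_cod x -> chart_map (chart_inv x) = x;
  chart_map_cont : forall p, chart_dom p -> {for p, continuous chart_map};
  chart_inv_cont : forall x, chart_cod x -> {for x, continuous chart_inv} }.

(* A smooth atlas together with a preferred chart around each point, which is
   used to identify the tangent spaces with the model space (see [tmap]). *)
Record smooth_structure (R : realType) (M : topologicalType)
    (E : normedModType R) := SmoothStructure {
  atlas : set (chart M E);
  chart_at : M -> chart M E;
  chart_at_atlas : forall p, atlas (chart_at p);
  chart_at_dom : forall p, chart_dom (chart_at p) p;
  atlas_smooth : forall c d, atlas c -> atlas d ->
    smooth_on (chart_cod c `&` chart_inv c @^-1` chart_dom d)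
              (d \o chart_inv c) }.

Record manifold (R : realType) (E : normedModType R) := Manifold {
  manifold_sort :> topologicalType;
  manifold_struct : smooth_structure manifold_sort E }.

Notation mchart_at := (chart_at (manifold_struct _)).
Notation matlas M := (atlas (manifold_struct M)).

#[local] Obligation Tactic := try by [].

Section Constructions.
Context {R : realType}.

Section VectorSpace.
Variable E : normedModType R.

Program Definition id_chart : chart E E :=
  @Chart R E E setT setT id id openT openT _ _ _ _ _ _.
Next Obligation. by move=> x _; exact: cvg_id. Qed.
Next Obligation. by move=> x _; exact: cvg_id. Qed.

Program Definition vs_structure : smooth_structure E E :=
  @SmoothStructure R E E [set id_chart] (fun=> id_chart) _ _ _.
Next Obligation. by move=> c d -> ->; exact: smooth_on_id. Qed.

Definition vs_manifold : manifold E := Manifold vs_structure.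
End VectorSpace.

Section Product.
Variables (E F : normedModType R).

Section ProductChart.
Variables (M N : topologicalType) (c : chart M E) (d : chart N F).

Program Definition prod_chart : chart (M * N)%type (E * F)%type :=
  @Chart R (M * N)%type (E * F)%type
    (chart_dom c `*` chart_dom d) (chart_cod c `*` chart_cod d)
    (fun p => (c p.1, d p.2)) (fun x => (chart_inv c x.1, chart_inv d x.2))
    (openX (chart_dom_open c) (chart_dom_open d))
    (openX (chart_cod_open c) (chart_cod_open d)) _ _ _ _ _ _.
Next Obligation. by move=> p [? ?]; split; exact: chart_mapP. Qed.
Next Obligation. by move=> p [? ?]; split; exact: chart_invP. Qed.
Next Obligation. by move=> [p q] [? ?] /=; rewrite !chart_mapK. Qed.
Next Obligation. by move=> [x y] [? ?] /=; rewrite !chart_invK. Qed.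
Next Obligation.
by move=> p [? ?]; apply: continuous_pair_map; exact: chart_map_cont.
Qed.
Next Obligation.
by move=> x [? ?]; apply: continuous_pair_map; exact: chart_inv_cont.
Qed.
End ProductChart.

Lemma chart_overlap_open (M : topologicalType) (c d : chart M E) :
  open (chart_cod c `&` chart_inv c @^-1` chart_dom d).
Proof.
rewrite openE => x [cx dx].
apply: filterI; first exact: open_nbhs_nbhs (conj (chart_cod_open c) cx).
apply: (chart_inv_cont cx).
exact: open_nbhs_nbhs (conj (chart_dom_open d) dx).
Qed.
End Product.

Program Definition prod_structure (E F : normedModType R)
    (M N : topologicalType) (A : smooth_structure M E)
    (B : smooth_structure N F) :
    smooth_structure (M * N)%type (E * F)%type :=
  @SmoothStructure R (M * N)%type (E * F)%type
    [set c | exists c1 c2, [/\ atlas A c1, atlas B c2 & c = prod_chart c1 c2]]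
    (fun p => prod_chart (chart_at A p.1) (chart_at B p.2)) _ _ _.
Next Obligation.
move=> E F M N A B p; exists (chart_at A p.1), (chart_at B p.2).
by split=> //; exact: chart_at_atlas.
Qed.
Next Obligation. by move=> E F M N A B p; split; exact: chart_at_dom. Qed.
Next Obligation.
move=> E F M N A B _ _ [c1 [c2 [Ac1 Bc2 ->]]] [d1 [d2 [Ad1 Bd2 ->]]].
have -> : chart_cod (prod_chart c1 c2) `&`
    chart_inv (prod_chart c1 c2) @^-1` chart_dom (prod_chart d1 d2) =
    (chart_cod c1 `&` chart_inv c1 @^-1` chart_dom d1) `*`
    (chart_cod c2 `&` chart_inv c2 @^-1` chart_dom d2).
  by apply/seteqP; split=> x /= [[? ?] [? ?]].
apply: (@smooth_on_prod _ _ _ _ _ _ _ (d1 \o chart_inv c1) (d2 \o chart_inv c2));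
  try exact: chart_overlap_open.
- exact: atlas_smooth Ac1 Ad1.
- exact: atlas_smooth Bc2 Bd2.
Qed.

Definition prod_manifold (E F : normedModType R) (M : manifold E)
    (N : manifold F) : manifold (E * F)%type :=
  Manifold (prod_structure (manifold_struct M) (manifold_struct N)).

End Constructions.

Section Smooth.
Context {R : realType} {E F : normedModType R}.
Variables (M : manifold E) (N : manifold F).

Definition smooth_map (f : M -> N) : Prop :=
  continuous f /\
  forall c d, matlas M c -> matlas N d ->
    smooth_on (chart_cod c `&` (f \o chart_inv c) @^-1` chart_dom d)
              (d \o f \o chart_inv c).

(* The tangent space at [p] is the model space [E], read in the preferred
   chart at [p]; this is the tangent map T_p M -> T_(f p) N. *)
Definition tmap (f : M -> N) (p : M) : {linear E -> F} :=
  'd (mchart_at (f p) \o f \o chart_inv (mchart_at p)) (mchart_at p p).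

Definition submersion (f : M -> N) : Prop :=
  smooth_map f /\ forall p w, exists u, tmap f p u = w.

End Smooth.

Definition velocity0 (R : realType) (E : normedModType R) (M : manifold E)
    (c : R -> M) : E :=
  tmap (c : vs_manifold R^o -> M) 0 (1 : R^o).

(* A vector field assigns to [p] an element of T_p M, that is of [E] read in
   the preferred chart at [p]. *)
Definition vector_field (R : realType) (E : normedModType R) (M : manifold E) :=
  M -> E.

Section VectorFields.
Context {R : realType} {E : normedModType R}.
Variable M : manifold E.

Definition in_chart (c : chart M E) (p : M) : {linear E -> E} :=
  tmap (c : M -> vs_manifold E) p.

Definition smooth_vf (X : vector_field M) : Prop :=
  forall c, matlas M c ->
    smooth_on (chart_cod c)
      (fun x => in_chart c (chart_inv c x) (X (chart_inv c x))).

Definition smooth_vf_family (X : R -> vector_field M) : Prop :=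
  forall c, matlas M c ->
    smooth_on ([set: R^o] `*` chart_cod c)
      (fun z : R^o * E =>
         in_chart c (chart_inv c z.2) (X z.1 (chart_inv c z.2))).

End VectorFields.

Record lieGroup (R : realType) (n : nat) := LieGroup {
  lie_sort :> topGroupType;
  lie_struct : smooth_structure lie_sort 'rV[R]_n;
  lie_hausdorff : hausdorff_space lie_sort;
  lie_second_countable : @second_countable lie_sort;
  lie_mul_smooth :
    smooth_map (M := prod_manifold (Manifold lie_struct) (Manifold lie_struct))
      (N := Manifold lie_struct)
      (fun x : lie_sort * lie_sort => (x.1 * x.2)%g);
  lie_inv_smooth :
    smooth_map (M := Manifold lie_struct) (N := Manifold lie_struct)
      (fun x : lie_sort => x^-1%g) }.

Definition lie_manifold (R : realType) (n : nat) (G : lieGroup R n) :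
  manifold 'rV[R]_n := Manifold (lie_struct G).

Coercion lie_manifold : lieGroup >-> manifold.

(* The Lie algebra T_1 G is ['rV[R]_n]. *)
Section LieGroups.
Context {R : realType} {n : nat} (G : lieGroup R n).

Definition Ad (a : G) : {linear 'rV[R]_n -> 'rV[R]_n} :=
  tmap (M := G) (N := G) (fun b : G => (a * b * a^-1)%g) 1%g.

(* Characterizes the exponential map: tau |-> exp (tau xi) is the
   one-parameter subgroup with velocity xi. *)
Definition is_exp (exp : 'rV[R]_n -> G) : Prop :=
  forall xi, let gamma := fun tau : R => exp (tau *: xi) in
  [/\ smooth_map (M := vs_manifold R^o) (N := G) gamma,
      forall s t, gamma (s + t) = (gamma s * gamma t)%g &
      velocity0 (M := G) gamma = xi].

End LieGroups.

Section Actions.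
Context {R : realType} {n : nat} {H : lieGroup R n}.
Context {E : normedModType R} {M : manifold E}.
Variables (act : H -> M -> M) (exp : 'rV[R]_n -> H).

Definition equivariant_vf (X : vector_field M) : Prop :=
  smooth_vf X /\ forall a p, X (act a p) = tmap (act a) p (X p).

Definition inf_gauge (psi : M -> 'rV[R]_n) : Prop :=
  smooth_map (psi : M -> vs_manifold 'rV[R]_n) /\
  forall a p, psi (act a p) = Ad a (psi p).

(* d/dtau|_0 exp(tau xi) p *)
Definition inf_action (xi : 'rV[R]_n) (p : M) : E :=
  velocity0 (fun tau : R => act (exp (tau *: xi)) p).

Definition partial_gauge (psi : M -> 'rV[R]_n) : vector_field M :=
  fun p => inf_action (psi p) p.

(* The orbit is an immersed submanifold whose tangent space at p is the image
   of the differential at 1 of the orbit map. *)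
Definition orbit_tangent (p : M) : set E :=
  range (tmap (M := H) (fun a : H => act a p) 1%g).

Definition rel_equilibrium (Z : vector_field M) (p : M) : Prop :=
  orbit_tangent p (Z p).

Definition is_velocity (Z : vector_field M) (p : M) (xi : 'rV[R]_n) : Prop :=
  Z p = inf_action xi p.

Definition smooth_path (X : R -> vector_field M) : Prop :=
  (forall l, equivariant_vf (X l)) /\ smooth_vf_family X.

Definition is_curve (T : topologicalType) (I : set R) (gamma : R -> T) : Prop :=
  [/\ open I, is_interval I, I 0 &
      forall t, I t -> {for t, continuous gamma}].

Definition rel_solution_curve (X : R -> vector_field M) (m : M)
    (I : set R) (gamma : R -> M * R) : Prop :=
  [/\ forall l, rel_equilibrium (X l) m,
      is_curve I gamma,
      gamma 0 = (m, 0) &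
      forall t, I t -> rel_equilibrium (X (gamma t).2) (gamma t).1].

End Actions.

Record lieSubgroup (R : realType) (n : nat) (G : lieGroup R n) (d : nat) :=
  LieSubgroup {
  subgroup_group :> lieGroup R d;
  incl : subgroup_group -> G;
  incl_smooth : smooth_map (M := subgroup_group) (N := G) incl;
  incl_mul : forall a b : subgroup_group, incl (a * b)%g = (incl a * incl b)%g;
  incl_inj : injective incl;
  incl_immersion : forall a : subgroup_group,
    injective (tmap (M := subgroup_group) (N := G) incl a) }.

Record representation (R : realType) (d : nat) (K : lieGroup R d) (m : nat) :=
  Representation {
  rep :> K -> {linear 'rV[R]_m -> 'rV[R]_m};
  rep1 : forall v, rep 1%g v = v;
  repM : forall a b v, rep (a * b)%g v = rep a (rep b v);
  rep_smooth : smooth_map (M := prod_manifold K (vs_manifold 'rV[R]_m))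
    (N := vs_manifold 'rV[R]_m) (fun x : K * 'rV[R]_m => rep x.1 x.2) }.

Definition rep_act (R : realType) (d m : nat) (K : lieGroup R d)
    (rho : representation K m) (k : K) (v : vs_manifold 'rV[R]_m) :
  vs_manifold 'rV[R]_m := rho k v.
Arguments rep_act {R d m K} rho k v.

Section AssociatedBundle.
Context {R : realType} {n d m : nat} {G : lieGroup R n} {K : lieSubgroup G d}.
Variable rho : representation K m.

Local Notation V := 'rV[R]_m.

Definition twist (k : K) (x : G * V) : G * V :=
  ((x.1 * (incl k)^-1)%g, rho k x.2).

Definition twist_rel (x y : G * V) : bool := `[< exists k, y = twist k x >].

Lemma incl1 : incl (1%g : K) = 1%g.
Proof.
by apply: (@mulgI _ (incl (1%g : K))); rewrite -incl_mul !mulg1.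
Qed.

Lemma twist1 x : twist 1%g x = x.
Proof. by case: x => g v; rewrite /twist /= incl1 invg1 mulg1 rep1. Qed.

Lemma twistM k l x : twist (k * l)%g x = twist k (twist l x).
Proof. by rewrite /twist /= incl_mul invgM mulgA repM. Qed.

Lemma twist_refl : reflexive twist_rel.
Proof. by move=> x; apply/asboolP; exists 1%g; rewrite twist1. Qed.

Lemma twist_symW x y : twist_rel x y -> twist_rel y x.
Proof.
move=> /asboolP[k ->]; apply/asboolP; exists k^-1%g.
by rewrite -twistM mulVg twist1.
Qed.

Lemma twist_sym : symmetric twist_rel.
Proof. by move=> x y; apply/idP/idP; exact: twist_symW. Qed.

Lemma twist_trans : transitive twist_rel.
Proof.
move=> y x z /asboolP[k ->] /asboolP[l ->]; apply/asboolP.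
by exists (l * k)%g; rewrite twistM.
Qed.

Canonical twist_equiv := EquivRel twist_rel twist_refl twist_sym twist_trans.

Definition assoc_quot : quotType (G * V)%type := {eq_quot twist_equiv}%qT.

(* G x^K V with the quotient topology. *)
Definition assoc_space : topologicalType := quotient_topology assoc_quot.

(* [cls g v] is the element [g, v] of G x^K V. *)
Definition cls (g : G) (v : V) : assoc_space := \pi_assoc_quot%qT (g, v).

Definition assoc_repr (x : assoc_space) : G * V := repr (x : assoc_quot).

End AssociatedBundle.

Section Splitting.
Context {R : realType} {n d : nat} {G : lieGroup R n}.
Variable K : lieSubgroup G d.

(* The inclusion of the Lie algebra of K into that of G, and its image. *)
Definition lie_incl : {linear 'rV[R]_d -> 'rV[R]_n} :=
  tmap (M := K) (N := G) (@incl _ _ _ _ K) 1%g.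

Definition subalg : {vspace 'rV[R]_n} := limg (linfun lie_incl).

Definition equivariant_splitting (q : {vspace 'rV[R]_n}) : Prop :=
  [/\ (subalg + q)%VS = fullv, (subalg :&: q)%VS = 0%VS &
      forall (k : K) xi, xi \in q -> Ad (incl k) xi \in q].

Definition splitting_proj (q : {vspace 'rV[R]_n}) : 'End('rV[R]_n) :=
  daddv_pi subalg q.

End Splitting.

Section AssociatedBundleGeometry.
Context {R : realType} {n d m N : nat} {G : lieGroup R n} {K : lieSubgroup G d}.
Context {rho : representation K m}.
Variable S : smooth_structure (assoc_space rho) 'rV[R]_N.

Local Notation V := (vs_manifold 'rV[R]_m).
Local Notation M := (Manifold S).

Definition assoc_proj (x : prod_manifold G V) : M := cls rho x.1 x.2.

(* By the quotient manifold theorem there is exactly one smooth structure on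
   G x^K V for which the quotient map is a submersion. *)
Definition is_quotient_structure : Prop := submersion assoc_proj.

Definition assoc_act (a : G) (x : M) : M :=
  cls rho (a * (assoc_repr x).1)%g (assoc_repr x).2.

Definition slice_incl (v : V) : M := cls rho 1%g v.

(* varpi : TG x TV -> T(G x^K V), where TG = G x g by left translation;
   [w] is tangent to V at [v]. *)
Definition varpi (g : G) (v : V) (xi : 'rV[R]_n) (w : 'rV[R]_m) : 'rV[R]_N :=
  tmap assoc_proj (g, v)
    (tmap (M := G) (N := G) (fun a : G => (g * a)%g) 1%g xi, w).

(* The value at [g, v] is computed from the representative (g, v) selected by
   [assoc_repr]; it does not depend on it when [Y] is K-equivariant. *)
Definition E0 (Y : vector_field V) : vector_field M := fun x =>
  let: (g, v) := assoc_repr x in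
  tmap (assoc_act g) (slice_incl v) (tmap slice_incl v (Y v)).

(* [Phi x] is the restriction of the connection to the tangent space at [x]. *)
Definition is_connection (q : {vspace 'rV[R]_n})
    (Phi : M -> 'rV[R]_N -> 'rV[R]_N) : Prop :=
  forall g v xi w,
    Phi (cls rho g v) (varpi g v xi w) = varpi g v (splitting_proj K q xi) w.

(* Only the values of [P0] and [h] on X(G x^K V)^G are constrained. *)
Definition is_P0 (Phi : M -> 'rV[R]_N -> 'rV[R]_N)
    (P0 : vector_field M -> vector_field V) : Prop :=
  forall X, equivariant_vf assoc_act X ->
    equivariant_vf (rep_act rho) (P0 X) /\
    forall v, tmap slice_incl v (P0 X v) = Phi (slice_incl v) (X (slice_incl v)).

Definition is_h (q : {vspace 'rV[R]_n}) (expG : 'rV[R]_n -> G)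
    (P0 : vector_field M -> vector_field V)
    (h : vector_field M -> M -> 'rV[R]_n) : Prop :=
  forall X, equivariant_vf assoc_act X ->
    [/\ inf_gauge assoc_act (h X),
        forall v, h X (slice_incl v) \in q &
        forall x, X x = E0 (P0 X) x + partial_gauge assoc_act expG (h X) x].

End AssociatedBundleGeometry.

Arguments assoc_act {R n d m N G K rho} S a x.

(* Main.v *)
(* At [1, v] every tangent vector of G x^K V is varpi(xi, w), where w is tangent to
   the slice and xi to the group orbit, and k.v and incl k give the same point
   [1, k.v] = [incl k, v].  Hence Tj maps the K-orbit direction zeta at v to the
   G-orbit direction lie_incl zeta, and X = Tj(P0 X) + (orbit direction h X) on the
   slice.  If P0 X v is an orbit direction, so is X [1, v]; conversely, applying
   Phi to X [1, v] = varpi(xi, 0) gives Tj(P0 X v) = varpi(P xi, 0) with P xi in the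
   Lie algebra of K, and one concludes by injectivity of Tj.  The velocities are
   read off the same identities.

   Injectivity of Tj, and differentiability of the action of a group element on the
   quotient, rest on a quantitative open mapping property of C^1 submersive maps
   into R^N (Graves' theorem). *)
Require Import Defs.
From HB Require Import structures.
From mathcomp Require Import all_boot all_order all_algebra.
From mathcomp Require Import all_classical all_reals all_analysis.
From mathcomp Require Import generic_quotient ring lra.
Import Order.TTheory GRing.Theory Num.Theory.
Import numFieldNormedType.Exports.
Local Open Scope classical_set_scope.
Local Open Scope ring_scope.
Set Implicit Arguments.
Unset Strict Implicit.
Unset Printing Implicit Defensive.

(** * Differentials and linear combinations *)

Section Differentiability.
Context {R : realType} {E F : normedModType R}.

Lemma differentiable_estimate (f : E -> F) (x : E) (e : R) :
  differentiable f x -> 0 < e ->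
  \forall y \near x, `|f y - f x - 'd f x (y - x)| <= e * `|y - x|.
Proof.
move=> df e0; have /eqaddoP/(_ e e0) := diff_locally df.
rewrite [X in _ -> X](near_shift 0 x); apply: filterS => y /=.
by rewrite /= !fctE /= subr0 addrK opprD addrA.
Qed.

Lemma is_diff_estimate (f : E -> F) (x : E) (L : {linear E -> F}) :
  continuous L ->
  (forall e, 0 < e ->
    \forall y \near x, `|f y - f x - L (y - x)| <= e * `|y - x|) ->
  is_diff x f L.
Proof.
move=> cL fL.
have eg : f \o shift x = cst (f x) + L +o_ 0 id.
  apply/eqaddoP => e e0; have := fL e e0; rewrite (near_shift 0 x).
  apply: filterS => y /=.
  by rewrite !fctE /= subr0 addrK opprD addrA.
have dL : 'd f x = L :> (E -> F) by rewrite (diff_unique cL eg).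
have df : differentiable f x by apply/diff_locallyP; rewrite dL.
exact: DiffDef df dL.
Qed.

End Differentiability.

Section Coordinate.
Context {R : realType} {N : nat} (k : 'I_N).

Definition rV_coord (s : 'rV[R]_N) : R := s ord0 k.

Fact rV_coord_is_linear : linear_for *%R rV_coord.
Proof. by move=> a s t; rewrite /rV_coord !mxE. Qed.

HB.instance Definition _ :=
  GRing.isLinear.Build R 'rV[R]_N R _ rV_coord rV_coord_is_linear.

Lemma is_diff_rV_coord (s : 'rV[R]_N) : is_diff s rV_coord rV_coord.
Proof.
have cc : continuous rV_coord by exact: coord_continuous.
by apply: DiffDef; [exact: linear_differentiable|rewrite diff_lin].
Qed.

End Coordinate.

Section LinearCombination.
Context {R : realType} {E : normedModType R} {N : nat} (u : 'I_N -> E).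

Lemma ler_coord_norm (s : 'rV[R]_N) i : `|s ord0 i| <= `|s|.
Proof.
rewrite [leRHS]/Num.Def.normr /= mx_normrE; apply/bigmax_geP; right.
by exists (ord0, i).
Qed.

Lemma rV_norm_le (s : 'rV[R]_N) (c : R) : 0 <= c ->
  (forall i, `|s ord0 i| <= c) -> `|s| <= c.
Proof.
move=> c0 sc; rewrite [leLHS]/Num.Def.normr /= mx_normrE; apply/bigmax_leP; split=> //.
by move=> [i j] _ /=; rewrite (ord1 i).
Qed.

(** When the [u i] are preimages of the basis vectors under a differential, this is a right inverse
    of that differential. *)
Definition rV_comb (s : 'rV[R]_N) : E := \sum_i s ord0 i *: u i.

Fact rV_comb_is_linear : linear rV_comb.
Proof.
move=> a s t; rewrite /rV_comb scaler_sumr -big_split /=.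
by apply: eq_bigr => i _; rewrite !mxE scalerDl scalerA.
Qed.

HB.instance Definition _ :=
  GRing.isLinear.Build R 'rV[R]_N E _ rV_comb rV_comb_is_linear.

Lemma rV_comb_bound (s : 'rV[R]_N) : `|rV_comb s| <= (\sum_i `|u i|) * `|s|.
Proof.
apply: le_trans (ler_norm_sum _ _ _) _.
rewrite mulr_suml; apply: ler_sum => i _.
by rewrite normrZ mulrC ler_wpM2l ?ler_coord_norm.
Qed.

End LinearCombination.

Lemma linear_continuous_bound (R : realType) (E F : normedModType R)
    (L : {linear E -> F}) (C : R) :
  (forall s, `|L s| <= C * `|s|) -> continuous L.
Proof.
move=> LC; apply/linear_bounded_continuous; rewrite /bounded_near.
near=> M; near=> s => /=.
have C0 : C <= `|C| by exact: ler_norm.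
apply: (le_trans (LC s)).
have : `|s| <= 1 by near: s; apply: nbhs0_le.
move=> s1; apply: (@le_trans _ _ `|C|).
  by apply: le_trans (ler_wpM2r _ C0) _; rewrite // ler_piMr.
by near: M; exact: nbhs_pinfty_ge.
Unshelve. all: by end_near. Qed.

(** * Graves' theorem *)

(** The mean value theorem is scalar, so derivatives along a segment are taken one coordinate at a
    time. *)
Lemma is_derive_line (R : realType) (E : normedModType R) (N : nat)
    (f : E -> 'rV[R]_N) (a w : E) (k : 'I_N) (t : R) :
  differentiable f (a + t *: w) ->
  is_derive t 1 (fun t : R => f (a + t *: w) ord0 k)
    ('d f (a + t *: w) w ord0 k).
Proof.
move=> df.
have dl : is_diff t (fun t : R => a + t *: w) (fun t : R => t *: w).
  have -> : (fun t : R => a + t *: w) = cst a + (fun t : R => t *: w) by [].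
  by apply: is_diff_eq; rewrite add0r.
have dfl := is_diff_comp dl (differentiableP df).
have dkfl := is_diff_comp dfl (is_diff_rV_coord k (f (a + t *: w))).
have dv := @ex_diff _ _ _ _ _ _ _ dkfl.
split; first exact/derivable1_diffP.
rewrite deriveE; last exact: dv.
by rewrite (@diff_val _ _ _ _ _ _ _ dkfl) /= scale1r.
Qed.

Section LocalSurjectivity.
Context {R : realType} {E : normedModType R} {N : nat}.
Variables (F : E -> 'rV[R]_N) (x : E) (u : 'I_N -> E).
Hypothesis dF : \forall z \near x, differentiable F z.
Hypothesis dF_cont : forall i, {for x, continuous (fun z => 'd F z (u i))}.
Hypothesis dF_u : forall i, 'd F x (u i) = delta_mx ord0 i.

(** By continuity, the derivatives of [F] along the [u i] stay close to the basis vectors near [x];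
    the mean value theorem on the segment from [a] then compares the increment of [F] with [s]. *)
Lemma strict_estimate : exists2 r, 0 < r &
  forall a s, `|a - x| < r -> `|a + rV_comb u s - x| < r ->
  `|F (a + rV_comb u s) - F a - s| <= 2^-1 * `|s|.
Proof.
(* Each of the [N] directions contributes an error of at most [c * |s|], so at most [|s| / 2] in
   total; [N.+1] keeps the denominator nonzero when [N = 0]. *)
pose c : R := (2 * N.+1%:R)^-1.
have c0 : 0 < c by rewrite invr_gt0 mulr_gt0.
have /nbhs_ballP[r r0 rP] : \forall z \near x, differentiable F z /\
    forall i, `|'d F z (u i) - delta_mx ord0 i| < c.
  apply: filterI => //; apply: filter_forall => i.
  have /cvgrPdist_lt/(_ c c0) := @dF_cont i.
  by apply: filterS => z; rewrite dF_u distrC.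
exists r => // a s ar asr; set w := rV_comb u s in asr *.
have seg (t : R) : 0 <= t <= 1 -> ball x r (a + t *: w).
  move=> /andP[t0 t1]; rewrite -ball_normE /= distrC.
  have -> : a + t *: w - x = (1 - t) *: (a - x) + t *: (a + w - x).
    rewrite (addrAC a w) (scalerDr t (a - x)) addrA -scalerDl subrK scale1r.
    by rewrite addrAC.
  apply: le_lt_trans (ler_normD _ _) _; rewrite !normrZ ger0_norm ?subr_ge0//.
  rewrite (ger0_norm t0).
  have Mr : Num.max `|a - x| `|a + w - x| < r by rewrite gt_max ar.
  apply: le_lt_trans Mr; set M := Num.max _ _.
  have aM : `|a - x| <= M by rewrite le_max lexx.
  have wM : `|a + w - x| <= M by rewrite le_max lexx orbT.
  by nra.
apply: rV_norm_le => [|k]; first by rewrite mulr_ge0 ?invr_ge0.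
(* From [t = 0] to [t = 1], [th] varies by the [k]-th coordinate of the residue to be bounded. *)
pose th t : R := F (a + t *: w) ord0 k - t * s ord0 k.
have dth (t : R) : 0 <= t <= 1 ->
    is_derive t 1 th ('d F (a + t *: w) w ord0 k - s ord0 k).
  move=> /seg/rP[dFt _].
  have d1 := is_derive_line k dFt.
  have d2 : is_derive t 1 (fun t : R => t * s ord0 k) (s ord0 k).
    have -> : (fun t : R => t * s ord0 k) = id * cst (s ord0 k) by [].
    apply: is_derive_eq.
    by rewrite scaler0 add0r [LHS]mulr1.
  exact: is_deriveB d1 d2.
have [t t01 tE] : exists2 t, t \in `[0, 1]%R &
    th 1 - th 0 = ('d F (a + t *: w) w ord0 k - s ord0 k) * (1 - 0).
  apply: (@MVT_segment R th
    (fun t : R => 'd F (a + t *: w) w ord0 k - s ord0 k)) => //.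
    move=> t; rewrite in_itv /= => /andP[/ltW t0 /ltW t1].
    by apply: dth; rewrite t0.
  apply: derivable_within_continuous => t; rewrite in_itv /= => tI.
  by case: (dth t tI).
move: t01; rewrite in_itv /= => /seg/rP[_ dFt].
have -> : (F (a + w) - F a - s) ord0 k =
    'd F (a + t *: w) w ord0 k - s ord0 k.
  rewrite -[RHS]mulr1 -[X in _ * X]subr0 -tE /th scale1r scale0r addr0.
  by rewrite mul1r mul0r subr0 !mxE addrAC.
(* As [w] is the combination of the [u i] with coefficients [s], the error is a combination of the
   deviations bounded by [c]. *)
have -> : 'd F (a + t *: w) w ord0 k - s ord0 k = 
   (\sum_i s ord0 i *: ('d F (a + t *: w) (u i) - delta_mx ord0 i)) ord0 k.
  rewrite {2}/w /rV_comb linear_sum /=.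
  under [in RHS]eq_bigr do rewrite scalerBr.
  rewrite sumrB -row_sum_delta !mxE; congr (_ - _).
  by rewrite !summxE; apply: eq_bigr => i _; rewrite linearZ.
apply: le_trans (ler_coord_norm _ _) _; apply: le_trans (ler_norm_sum _ _ _) _.
apply: (@le_trans _ _ (\sum_(i < N) `|s| * c)).
  apply: ler_sum => i _; rewrite normrZ ler_pM ?ler_coord_norm//.
  exact: ltW (dFt i).
rewrite sumr_const card_ord -mulrnAr mulrC ler_wpM2r // -mulr_natr /c.
rewrite invfM -mulrA ler_piMr ?invr_ge0 // mulrC ler_pdivrMr// mul1r.
by rewrite ler_nat.
Qed.

(* The witness minimizes [s |-> `|y - F (z + u s)| + `|s| / 4] on a compact ball:
   at a minimizer with residue [e = y - F (z + u s) != 0], replacing [s] by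
   [s + e] would halve the residue. *)
Lemma local_surjectivity : exists2 r, 0 < r &
  forall z y, `|z - x| < r -> `|y - F x| < r ->
  exists2 s, `|s| <= 4 * `|y - F z| & F (z + rV_comb u s) = y.
Proof.
have [r r0 rP] := strict_estimate.
have /nbhs_ballP[r1 /= r10 r1P] := dF.
pose rho := Num.min r r1; pose a : R := 1 + \sum_i `|u i|.
have rho0 : 0 < rho by rewrite lt_min r0.
have a0 : 0 < a by rewrite ltr_wpDr ?sumr_ge0.
(* Bounding both [y - F x] and [F x - F z] by this gives [|y - F z| < rho / (10 * a)]; a parameter
   [s] of norm at most [5 * |y - F z|] then moves [z] by less than [rho / 2]. *)
have d0 : 0 < rho / (20 * a) by rewrite divr_gt0 ?mulr_gt0.
have cF : {for x, continuous F}.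
  exact/differentiable_continuous/(nbhs_singleton dF).
have /cvgrPdist_lt/(_ _ d0)/nbhs_ballP[r2 /= r20 r2P] := cF.
exists (Num.min (rho / 2) (Num.min r2 (rho / (20 * a)))).
  by rewrite !lt_min divr_gt0// r20.
move=> z y; rewrite !lt_min => /and3P[zx1 zx2 _] /and3P[_ _ yx].
have e0_small : `|y - F z| < rho / (10 * a).
  have -> : y - F z = (y - F x) + (F x - F z) by rewrite addrA subrK.
  have -> : rho / (10 * a) = rho / (20 * a) + rho / (20 * a).
    by field; rewrite gt_eqF.
  apply: le_lt_trans (ler_normD _ _) _; apply: ltrD => //.
  by apply: r2P; rewrite -ball_normE /= distrC.
set e0 := `|y - F z| in e0_small *.
have near_x s : `|s| <= 5 * e0 -> `|z + rV_comb u s - x| < rho.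
  move=> se; rewrite addrAC; apply: le_lt_trans (ler_normD _ _) _.
  have us : `|rV_comb u s| <= a * `|s|.
    apply: le_trans (rV_comb_bound _ _) _; rewrite ler_wpM2r//.
    by rewrite lerDr.
  have : a * `|s| <= a * (5 * e0) by rewrite ler_pM2l.
  have : a * (5 * e0) < rho / 2.
    have -> : rho / 2 = a * (5 * (rho / (10 * a))).
      by field; rewrite gt_eqF.
    by rewrite ltr_pM2l// ltr_pM2l.
  by lra.
(* Since [f 0 = e0], a minimizer has norm at most [4 * e0] and residue at most [e0]; the radius
   [5 * e0] leaves room for [s + e]. *)
pose f s := `|y - F (z + rV_comb u s)| + 4^-1 * `|s|.
have [s] : exists2 s, s \in closed_ball_ Num.norm (0 : 'rV[R]_N) (5 * e0) &
    forall t, t \in closed_ball_ Num.norm (0 : 'rV[R]_N) (5 * e0) ->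
    f s <= f t.
  apply: EVT_min_rV.
  - by exists 0; rewrite /closed_ball_ /= subrr normr0 mulr_ge0 ?normr_ge0.
  - apply: bounded_closed_compact; last exact: closed_closed_ball_.
    exists (5 * e0); split; first exact: num_real.
    move=> M eM s; rewrite /closed_ball_ /= sub0r normrN => /le_trans; apply.
    exact: ltW.
  - apply: continuous_in_subspaceT => s; rewrite inE /closed_ball_ /=.
    rewrite sub0r normrN => se.
    have cn : {for s, continuous (fun s : 'rV[R]_N => `|s|)}.
      exact: norm_continuous.
    have c4 : {for s, continuous (cst (4^-1 : R) : 'rV[R]_N -> R)}.
      exact: cst_continuous.
    have cu : continuous (rV_comb u).
      exact: linear_continuous_bound (rV_comb_bound u).
    have cz : {for s, continuous (cst z + rV_comb u)}.
      by apply: continuousD; [exact: cst_continuous|exact: cu].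
    have cFz : {for s, continuous (F \o (cst z + rV_comb u))}.
      apply: continuous_comp cz _.
      apply/differentiable_continuous/r1P; rewrite -ball_normE /= distrC.
      by apply: lt_le_trans (near_x s se) _; rewrite ge_min lexx orbT.
    have cy : {for s, continuous (cst y - (F \o (cst z + rV_comb u)))}.
      by apply: continuousB => //; exact: cst_continuous.
    have cny : {for s, continuous
        (Num.norm \o (cst y - (F \o (cst z + rV_comb u))))}.
      by apply: continuous_comp cy _; exact: norm_continuous.
    exact: continuousD cny (continuousM c4 cn).
move=> /set_mem; rewrite /closed_ball_ /= sub0r normrN => se smin.
have fs0 : f s <= e0.
  have f0 : f 0 = e0 by rewrite /f linear0 addr0 normr0 mulr0 addr0.
  rewrite -f0; apply: smin; rewrite inE /closed_ball_ /= subrr normr0.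
  by rewrite mulr_ge0 ?normr_ge0.
have res_ge0 : 0 <= `|y - F (z + rV_comb u s)| by [].
have s_ge0 : 0 <= `|s| by [].
have s4 : `|s| <= 4 * e0 by move: fs0; rewrite /f; lra.
exists s => //; apply/eqP; rewrite eq_sym -subr_eq0 -normr_eq0.
set e := y - F (z + rV_comb u s) in res_ge0 *.
have ee0 : `|e| <= e0 by move: fs0; rewrite /f -/e; lra.
have te : `|s + e| <= 5 * e0.
  by apply: le_trans (ler_normD _ _) _; lra.
have := smin (s + e); rewrite inE /closed_ball_ /= sub0r normrN => /(_ te).
have half : `|y - F (z + rV_comb u (s + e))| <= 2^-1 * `|e|.
  have zse : z + rV_comb u s + rV_comb u e = z + rV_comb u (s + e).
    by rewrite (linearD (rV_comb u) s e) addrA.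
  have := rP (z + rV_comb u s) e; rewrite zse.
  have rhor v : v < rho -> v < r by rewrite lt_min => /andP[].
  move=> /(_ (rhor _ (near_x _ se)) (rhor _ (near_x _ te))).
  apply: le_trans; rewrite distrC /e opprB.
  by rewrite [X in _ <= `|X|]addrA subrK.
have tn := ler_normD s e.
(* Minimality gives [|e| + |s| / 4 <= |e| / 2 + (|s| + |e|) / 4], so [|e| <= 3 / 4 * |e|]. *)
by rewrite /f -/e => fle; apply/eqP; lra.
Qed.

End LocalSurjectivity.

(** * Submersions and tangent maps *)

Section Submersive.
Context {R : realType} {E W : normedModType R} {N : nat}.

Lemma submersive_right_inverse (F : E -> 'rV[R]_N) (U : set E) (x : E) :
  open U -> U x -> Ck_on 1 U F -> (forall w, exists v, 'd F x v = w) ->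
  exists u : 'I_N -> E,
    (forall s, 'd F x (rV_comb u s) = s) /\
    exists2 r, 0 < r & forall z y, `|z - x| < r -> `|y - F x| < r ->
      exists2 s, `|s| <= 4 * `|y - F z| & F (z + rV_comb u s) = y.
Proof.
move=> oU Ux [dF dF_cont] dF_surj.
have [u uE] := choice (fun i : 'I_N => dF_surj (delta_mx ord0 i)).
exists u; split=> [s|].
  rewrite /rV_comb linear_sum /= [RHS]row_sum_delta; apply: eq_bigr => i _.
  by rewrite linearZ /= uE.
apply: local_surjectivity => // [|i]; last exact: dF_cont.
by apply: filterS (open_nbhs_nbhs (conj oU Ux)).
Qed.

(** Every [y] near [F x] is [F z] for some [z] with [|z - x|] of order [|y - F x|]. The expansions
    of [F] and [H] at [x] thus yield one of [f] at [F x], with differential ['d H x] after the right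
    inverse of ['d F x]. *)
Lemma differentiable_descend (F : E -> 'rV[R]_N) (f : 'rV[R]_N -> W)
    (H : E -> W) (x : E) (u : 'I_N -> E) (r : R) :
  (forall s, 'd F x (rV_comb u s) = s) -> 0 < r ->
  (forall y, `|y - F x| < r ->
    exists2 s, `|s| <= 4 * `|y - F x| & F (x + rV_comb u s) = y) ->
  (\forall z \near x, f (F z) = H z) ->
  differentiable F x -> differentiable H x -> differentiable f (F x).
Proof.
move=> dFu r0 Fsurj fH dF dH.
have cu : continuous (rV_comb u) by exact: linear_continuous_bound (rV_comb_bound u).
have cH : continuous ('d H x) by exact: diff_continuous.
pose L : {linear _ -> _} := 'd H x \o rV_comb u.
have cL : continuous L by move=> s; exact: continuous_comp (cu s) (cH _).
suff dfL : is_diff (F x) f L by case: dfL.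
have [l l0 Ll] := linear_lipschitz cL.
pose a : R := 1 + \sum_i `|u i|.
have a0 : 0 < a by rewrite ltr_wpDr ?sumr_ge0.
have ua s : `|rV_comb u s| <= a * `|s|.
  apply: le_trans (rV_comb_bound _ _) _; rewrite ler_wpM2r//.
  by rewrite lerDr.
apply: is_diff_estimate => // e e0.
(* The remainders of [F] and [H] contribute at most [(1 + l) * e1 * |z - x|], and
   [|z - x| <= 4 * a * |F z - F x|]; this choice makes the total [e * |F z - F x|]. *)
pose e1 := e / (4 * a * (1 + l)).
have l1 : 0 < 1 + l by rewrite addr_gt0.
have e10 : 0 < e1 by rewrite divr_gt0 // !mulr_gt0.
have [r1 /= r10 r1P] : exists2 r1 : R, 0 < r1 & forall z, `|z - x| < r1 ->
    [/\ f (F z) = H z, `|F z - F x - 'd F x (z - x)| <= e1 * `|z - x| &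
      `|H z - H x - 'd H x (z - x)| <= e1 * `|z - x|].
  have /nbhs_ballP[r1 /= r10 r1P] : \forall z \near x,
      [/\ f (F z) = H z, `|F z - F x - 'd F x (z - x)| <= e1 * `|z - x| &
      `|H z - H x - 'd H x (z - x)| <= e1 * `|z - x|].
    move: fH (differentiable_estimate dF e10) (differentiable_estimate dH e10).
    by apply: filterS3.
  exists r1 => // z zx; apply: r1P; by rewrite -ball_normE /= distrC.
have r2 : 0 < Num.min r (r1 / (4 * a)) by rewrite lt_min r0 divr_gt0 ?mulr_gt0.
apply/nbhs_ballP; exists (Num.min r (r1 / (4 * a))) => //= y.
rewrite -ball_normE /= distrC lt_min => /andP[/Fsurj[s s4 ys] yr1]; subst y.
set z := x + rV_comb u s in s4 yr1 *; set D := `|F z - F x| in s4 yr1 *.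
have zx : z - x = rV_comb u s by rewrite /z addrC addKr.
have zD : `|z - x| <= 4 * a * D.
  rewrite zx; apply: le_trans (ua s) _.
  by have := ler_wpM2l (ltW a0) s4; rewrite mulrA [a * 4]mulrC.
have /r1P[-> Fz Hz] : `|z - x| < r1.
  apply: le_lt_trans zD _; by rewrite mulrC -ltr_pdivlMr ?mulr_gt0.
have /r1P[-> _ _] : `|x - x| < r1 by rewrite subrr normr0.
(* As [L] sends ['d F x (z - x) = s] to ['d H x (z - x)], the remainder of [f] is that of [H] minus
   the image under [L] of that of [F]. *)
have -> : H z - H x - L (F z - F x) =
    (H z - H x - 'd H x (z - x)) - L (F z - F x - 'd F x (z - x)).
  rewrite zx dFu (linearB L (F z - F x)) [L s]/= opprB addrA.
  by rewrite subrK.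
apply: le_trans (ler_normB _ _) _.
have LF := Ll (F z - F x - 'd F x (z - x)).
have := ler_wpM2l (ltW l0) Fz; have := ler_wpM2l (ltW e10) zD.
have -> : e * D = (1 + l) * (e1 * (4 * a * D)).
  by rewrite /e1; field; rewrite !gt_eqF.
move: Hz Fz LF; set h1 := `|H z - _ - _|; set h2 := `|L _|; set h3 := `|F z - _ - _|.
set q := `|z - x| => h1q h3q h2h3 qD lh3.
have := ler_wpM2l (ltW l0) qD; nra.
Qed.

End Submersive.

(** Read in the preferred charts, as [tmap] is. Continuity keeps the images of nearby points in the
    domain of the chart at [f p], outside of which the chart map carries no information. *)
Definition mdiff {R : realType} {E F : normedModType R} {M : manifold E}
    {N : manifold F}
    (f : M -> N) (p : M) : Prop :=
  {for p, continuous f} /\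
  differentiable (mchart_at (f p) \o f \o chart_inv (mchart_at p))
                 (mchart_at p p).

Section PreferredChart.
Context {R : realType} {E F : normedModType R}.

Lemma mchart_atK {M : manifold E} (p : M) :
  chart_inv (mchart_at p) (mchart_at p p) = p.
Proof. by rewrite chart_mapK //; exact: chart_at_dom. Qed.

Lemma chart_inv_cvg {M : manifold E} (p : M) (A : set M) : nbhs p A ->
  \forall x \near mchart_at p p, A (chart_inv (mchart_at p) x).
Proof.
move=> pA; have cp : chart_cod (mchart_at p) (mchart_at p p).
  by apply: chart_mapP; exact: chart_at_dom.
by apply: (chart_inv_cont cp); rewrite mchart_atK.
Qed.

Lemma nbhs_chart_dom {M : manifold E} (p : M) :
  nbhs p (chart_dom (mchart_at p)).
Proof.
apply: open_nbhs_nbhs; split; first exact: chart_dom_open.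
exact: chart_at_dom.
Qed.

Lemma chart_map_cvg {M : manifold E} (p : M) (A : set E) :
  nbhs (mchart_at p p) A ->
  \forall q \near p, chart_dom (mchart_at p) q /\ A (mchart_at p q).
Proof.
move=> pA; apply: filterI; first exact: nbhs_chart_dom.
exact: (chart_map_cont (chart_at_dom _ p)) pA.
Qed.

Lemma chart_cod_near {M : manifold E} (p : M) :
  nbhs (mchart_at p p) (chart_cod (mchart_at p)).
Proof.
apply: open_nbhs_nbhs; split; first exact: chart_cod_open.
by apply: chart_mapP; exact: chart_at_dom.
Qed.

Lemma tmap_near {M : manifold E} {N : manifold F} (f : M -> N) (p : M)
    (g : E -> F) (dg : E -> F) :
  (\forall x \near mchart_at p p,
     g x = (mchart_at (f p) \o f \o chart_inv (mchart_at p)) x) ->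
  is_diff (mchart_at p p) g dg ->
  differentiable (mchart_at (f p) \o f \o chart_inv (mchart_at p))
                 (mchart_at p p) /\ forall v, tmap f p v = dg v.
Proof.
move=> gf dgp; have [df ddf] := near_eq_is_diff gf (@ex_diff _ _ _ _ _ _ _ dgp).
by split=> // v; rewrite /tmap ddf (@diff_val _ _ _ _ _ _ _ dgp).
Qed.

End PreferredChart.

Section ManifoldCalculus.
Context {R : realType} {E F E' : normedModType R}.

Lemma smooth_mdiff {M : manifold E} {N : manifold F} (f : M -> N) :
  smooth_map f -> forall p, mdiff f p.
Proof.
move=> [cf sf] p; split; first exact: cf.
have [df _] := sf _ _ (chart_at_atlas _ p) (chart_at_atlas _ (f p)) 1%N.
apply: df; split; last by rewrite /= mchart_atK; exact: chart_at_dom.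
by apply: chart_mapP; exact: chart_at_dom.
Qed.

(** Chain rule: by continuity of [f], points near [p] go to the domain of the chart at [f p], where
    this chart cancels against its inverse. *)
Lemma tmap_comp {M : manifold E} {N : manifold F} {P : manifold E'}
    (f : M -> N) (g : N -> P) (p : M) : mdiff f p -> mdiff g (f p) ->
  mdiff (g \o f) p /\
  forall v, tmap (g \o f) p v = tmap g (f p) (tmap f p v).
Proof.
move=> [cf df] [cg dg].
have near_comp : \forall x \near mchart_at p p,
    ((mchart_at (g (f p)) \o g \o chart_inv (mchart_at (f p))) \o
     (mchart_at (f p) \o f \o chart_inv (mchart_at p))) x =
    (mchart_at ((g \o f) p) \o (g \o f) \o chart_inv (mchart_at p)) x.
  have := chart_inv_cvg (cf _ (nbhs_chart_dom (f p))).
  by apply: filterS => x /= fx; rewrite chart_mapK.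
have dg' : is_diff ((mchart_at (f p) \o f \o chart_inv (mchart_at p))
    (mchart_at p p)) (mchart_at (g (f p)) \o g \o chart_inv (mchart_at (f p)))
    (tmap g (f p)).
  by rewrite /= mchart_atK; exact: differentiableP.
have [dgf tgf] := tmap_near near_comp (is_diff_comp (differentiableP df) dg').
by split=> //; split=> //; exact: continuous_comp.
Qed.

Lemma tmap_id {M : manifold E} (p : M) :
  mdiff (id : M -> M) p /\ forall v, tmap (id : M -> M) p v = v.
Proof.
have [|di ti] := @tmap_near _ _ _ M M id p id id _ (is_diff_id _); last first.
  by split=> //; split=> //; exact: cvg_id.
by apply: filterS (chart_cod_near p) => x xc /=; rewrite chart_invK.
Qed.

Lemma tmap_cst {M : manifold E} {N : manifold F} (q : N) (p : M) :
  mdiff (fun=> q : N) p /\ forall v, tmap (fun _ : M => q) p v = 0.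
Proof.
have [|di ti] := @tmap_near _ _ _ M N (fun=> q) p _ _ _
    (is_diff_cst (mchart_at q q) (mchart_at p p)); first exact: filterE.
by split=> //; split=> //; exact: cst_continuous.
Qed.

Lemma tmap_pair {M : manifold E} {N : manifold F} {P : manifold E'}
    (f : M -> N) (g : M -> P) (p : M) : mdiff f p -> mdiff g p ->
  mdiff ((fun x => (f x, g x)) : M -> prod_manifold N P) p /\
  forall v, tmap ((fun x => (f x, g x)) : M -> prod_manifold N P) p v =
    (tmap f p v, tmap g p v).
Proof.
move=> [cf df] [cg dg].
have dfg := is_diff_pair (differentiableP df) (differentiableP dg).
have [|di ti] := @tmap_near _ _ _ _ (prod_manifold N P) (fun x => (f x, g x)) p _ _ _ dfg.
  exact: filterE.
by split=> //; split=> //; exact: cvg_pair.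
Qed.

Lemma mdiff_fst {M : manifold E} {N : manifold F} (x : prod_manifold M N) :
  mdiff (M := prod_manifold M N) (N := M) fst x.
Proof.
have cfst : continuous (fst : E * F -> E) by move=> y; exact: cvg_fst.
have dfst : is_diff (mchart_at x x) (fst : E * F -> E) fst.
  by apply: DiffDef; [exact: linear_differentiable|rewrite diff_lin].
have [|di _] := @tmap_near _ _ _ (prod_manifold M N) M fst x _ _ _ dfst.
  have := chart_cod_near x.
  by apply: filterS => y [y1 _] /=; rewrite chart_invK.
by split=> //; exact: cvg_fst.
Qed.

Lemma mdiff_snd {M : manifold E} {N : manifold F} (x : prod_manifold M N) :
  mdiff (M := prod_manifold M N) (N := N) snd x.
Proof.
have csnd : continuous (snd : E * F -> F) by move=> y; exact: cvg_snd.
have dsnd : is_diff (mchart_at x x) (snd : E * F -> F) snd.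
  by apply: DiffDef; [exact: linear_differentiable|rewrite diff_lin].
have [|di _] := @tmap_near _ _ _ (prod_manifold M N) N snd x _ _ _ dsnd.
  have := chart_cod_near x.
  by apply: filterS => y [_ y2] /=; rewrite chart_invK.
by split=> //; exact: cvg_snd.
Qed.

End ManifoldCalculus.

Section Submersions.
Context {R : realType} {E F : normedModType R} {N : nat}.
Context {P : manifold E} {M : manifold 'rV[R]_N} {Q : manifold F}.

Lemma chart_preimage_open (f : P -> M) (c : chart P E) (d : chart M 'rV[R]_N) :
  continuous f ->
  open (chart_cod c `&` (f \o chart_inv c) @^-1` chart_dom d).
Proof.
move=> cf; rewrite openE => x [cx dx]; apply: filterI.
  exact: open_nbhs_nbhs (conj (chart_cod_open c) cx).
have cfx : {for x, continuous (f \o chart_inv c)}.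
  by apply: continuous_comp; [exact: chart_inv_cont|exact: cf].
apply: cfx.
exact: open_nbhs_nbhs (conj (chart_dom_open d) dx).
Qed.

Lemma submersion_right_inverse (f : P -> M) (p : P) : submersion f ->
  let Fp := mchart_at (f p) \o f \o chart_inv (mchart_at p) in
  let x := mchart_at p p in
  exists u : 'I_N -> E,
    (forall s, 'd Fp x (rV_comb u s) = s) /\
    exists2 r, 0 < r & forall z y, `|z - x| < r -> `|y - Fp x| < r ->
      exists2 s, `|s| <= 4 * `|y - Fp z| & Fp (z + rV_comb u s) = y.
Proof.
move=> [[cf sf] df] Fp x.
have oU := chart_preimage_open (mchart_at p) (mchart_at (f p)) cf.
have Ux : (chart_cod (mchart_at p) `&`
    (f \o chart_inv (mchart_at p)) @^-1` chart_dom (mchart_at (f p))) x.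
  split; first by apply: chart_mapP; exact: chart_at_dom.
  by rewrite /= mchart_atK; exact: chart_at_dom.
have CU := sf _ _ (chart_at_atlas _ p) (chart_at_atlas _ (f p)) 1%N.
exact: submersive_right_inverse oU Ux CU (df p).
Qed.

Lemma submersion_descend (f : P -> M) (g : M -> Q) (p : P) : submersion f ->
  {for f p, continuous g} -> mdiff (g \o f) p -> mdiff g (f p).
Proof.
move=> sf cg [_ dgf]; split=> //.
have [u [du [r r0 ru]]] := submersion_right_inverse p sf.
have [_ df] := smooth_mdiff sf.1 p.
rewrite -[X in mchart_at (f p) (f X)](mchart_atK p).
apply: (differentiable_descend du r0 _ _ df dgf) => [y yr|].
  by apply: ru => //; rewrite subrr normr0.
have := chart_inv_cvg (sf.1.1 p _ (nbhs_chart_dom (f p))).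
by apply: filterS => x /= fx; rewrite chart_mapK.
Qed.

End Submersions.

(** * Lower bounds for immersions; injective maps from compact spaces *)

Section LowerBound.
Context {R : realType}.

Lemma rV_linear_bound (n : nat) (W : normedModType R)
    (L : {linear 'rV[R]_n -> W}) :
  exists2 C, 0 < C & forall s, `|L s| <= C * `|s|.
Proof.
pose u i := L (delta_mx ord0 i).
exists (1 + \sum_i `|u i|); first by rewrite ltr_wpDr ?sumr_ge0.
move=> s; have -> : L s = rV_comb u s.
  rewrite [in LHS](row_sum_delta s) linear_sum; apply: eq_bigr => i _.
  by rewrite linearZ.
apply: le_trans (rV_comb_bound u s) _; rewrite ler_wpM2r//.
by rewrite lerDr.
Qed.

(** The pseudo-inverse of a row-free matrix is a one-sided inverse recovering [s] from [D s]; [C]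
    bounds it. *)
Lemma injective_linear_lower_bound (d n : nat)
    (D : {linear 'rV[R]_d -> 'rV[R]_n}) : injective D ->
  exists2 C, 0 < C & forall s, `|s| <= C * `|D s|.
Proof.
move=> D_inj; have freeD : row_free (lin1_mx D).
  apply: inj_row_free => s; rewrite mul_rV_lin1 => Ds.
  by apply: D_inj; rewrite Ds linear0.
have [C C0 CP] := rV_linear_bound (mulmxr (pinvmx (lin1_mx D)) :
  {linear 'rV[R]_n -> 'rV[R]_d}).
exists C => // s; apply: le_trans (CP _).
by rewrite /= -mul_rV_lin1 -mulmxA mulmxVp// mulmx1.
Qed.

Lemma immersion_lower_bound (d n : nat) (f : 'rV[R]_d -> 'rV[R]_n) x :
  differentiable f x -> injective ('d f x) ->
  exists2 C, 0 < C & \forall y \near x, `|y - x| <= C * `|f y - f x|.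
Proof.
move=> df /injective_linear_lower_bound[C C0 CP].
exists (2 * C); first by rewrite mulr_gt0.
(* With this tolerance, [C] times the remainder is at most [|y - x| / 2], which the left-hand side
   absorbs. *)
have C2 : 0 < (2 * C)^-1 by rewrite invr_gt0 mulr_gt0.
apply: filterS (differentiable_estimate df C2) => y fy.
have h := CP (y - x); apply: le_trans h _.
have {fy} : `|'d f x (y - x)| <= `|f y - f x| + (2 * C)^-1 * `|y - x|.
  rewrite -[X in `|X| <= _](subKr (f y - f x)) (le_trans (ler_normB _ _))//.
  by rewrite lerD2l.
have := CP (y - x).
set a := `|y - x|; set b := `|'d f x _|; set c := `|f y - f x| => ab bc.
have : C * b <= C * (c + (2 * C)^-1 * a) by rewrite ler_pM2l.
have -> : C * (c + (2 * C)^-1 * a) = C * c + a / 2.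
  by field; rewrite gt_eqF.
by lra.
Qed.

Lemma differentiable_lipschitz (E F : normedModType R) (f : E -> F) x :
  differentiable f x ->
  exists2 C, 0 < C & \forall y \near x, `|f y - f x| <= C * `|y - x|.
Proof.
move=> df; have [C C0 CP] := linear_lipschitz (diff_continuous df).
exists (C + 1); first by rewrite addr_gt0.
apply: filterS (differentiable_estimate df ltr01) => y fy.
rewrite -[X in `|X| <= _](subrK ('d f x (y - x))) addrC mulrDl.
by apply: le_trans (ler_normD _ _) _; exact: lerD.
Qed.

End LowerBound.

(** The complement of an open neighbourhood of [k0] is compact, so its image is closed in the
    Hausdorff space [G], and by injectivity it misses [f k0]. *)
Lemma compact_injective_near (K G : topologicalType) (f : K -> G) (k0 : K)
    (W : set K) : compact [set: K] -> hausdorff_space G -> continuous f ->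
  injective f -> nbhs k0 W ->
  \forall g \near f k0, forall k, f k = g -> W k.
Proof.
move=> cK hG cf f_inj; rewrite nbhsE => -[B [oB Bk0] BW].
have cB : compact (f @` (~` B)).
  apply: continuous_compact; first exact: continuous_subspaceT.
  by apply: subclosed_compact cK _ => //; exact: open_closedC.
have oC : open (~` (f @` (~` B))) by apply: closed_openC; exact: compact_closed.
have Ck0 : (~` (f @` (~` B))) (f k0) by move=> [k Bk /f_inj kk0]; rewrite kk0 in Bk.
apply: filterS (open_nbhs_nbhs (conj oC Ck0)) => g Cg k fk.
by apply: BW; apply: contrapT => Bk; apply: Cg; exists k.
Qed.

(** * The associated bundle *)

Section InfinitesimalAction.
Context {R : realType} {n : nat} {H : lieGroup R n}.
Context {E : normedModType R} {M : manifold E}.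

(** Chain rule along the one-parameter subgroup, which is at [1] at time 0. This ties the curves
    that define velocities to the differential that defines [orbit_tangent]. *)
Lemma inf_action_orbit (act : H -> M -> M) (exp : 'rV[R]_n -> H) (p : M) xi :
  is_exp exp -> mdiff (M := H) (fun a => act a p) 1%g ->
  inf_action act exp xi p = tmap (M := H) (fun a => act a p) 1%g xi.
Proof.
move=> /(_ xi) /= [sg gD gv] dact.
have exp0 : exp (0 *: xi) = 1%g.
  by apply: (@mulgI _ (exp (0 *: xi))); rewrite -gD addr0 mulg1.
have dact0 : mdiff (M := H) (fun a => act a p) (exp ((0 : R) *: xi)).
  by rewrite exp0.
have [_ tE] := tmap_comp (smooth_mdiff sg 0) dact0.
by rewrite /inf_action /velocity0 (tE 1) exp0 -[in RHS]gv.
Qed.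

End InfinitesimalAction.

Section AssociatedBundleCalculus.
Context {R : realType} {n d m N : nat} {G : lieGroup R n} {K : lieSubgroup G d}.
Context {rho : representation K m}.
Variable S : smooth_structure (assoc_space rho) 'rV[R]_N.
Hypothesis S_quot : is_quotient_structure S.

Local Notation V := (vs_manifold 'rV[R]_m).
Local Notation M := (Manifold S).

Lemma cls_eq g v g' v' : cls rho g v = cls rho g' v' ->
  exists k, (g', v') = twist rho k (g, v).
Proof. by move=> /eqquotP/asboolP. Qed.

Lemma cls_twist k g v : cls rho (g * (Defs.incl k)^-1)%g (rho k v) = cls rho g v.
Proof.
by apply/esym/eqquotP/asboolP; exists k.
Qed.

Lemma cls_repr (x : M) : cls rho (assoc_repr x).1 (assoc_repr x).2 = x.
Proof. by rewrite /cls -surjective_pairing; exact: (@reprK _ (assoc_quot rho)). Qed.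

(** The chosen representative differs from [(g, v)] by a twist, which multiplies on the right and so
    commutes with left multiplication by [a]. *)
Lemma assoc_actE a g v : assoc_act S a (cls rho g v) = cls rho (a * g)%g v.
Proof.
rewrite /assoc_act; have [k] := cls_eq (cls_repr (cls rho g v)).
by case: (assoc_repr _) => g0 v0 [-> ->] /=; rewrite mulgA cls_twist.
Qed.

Lemma mdiff_proj x : mdiff (assoc_proj S) x.
Proof. exact: smooth_mdiff S_quot.1 x. Qed.

(** This lemma and the next give the partial differentials of the quotient map, by inserting a
    constant in the other factor. *)
Lemma tmap_cls_l g v : mdiff (M := G) (N := M) (fun a => cls rho a v) g /\
  forall xi, tmap (M := G) (N := M) (fun a => cls rho a v) g xi =
    tmap (assoc_proj S) (g, v) (xi, 0).
Proof.
have [di ti] := @tmap_id _ _ G g; have [dc tc] := @tmap_cst _ _ _ G V v g.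
have [dp tp] := tmap_pair di dc.
have [dq tq] := tmap_comp dp (mdiff_proj (g, v)).
by split=> // xi; rewrite (tq xi) tp ti tc.
Qed.

Lemma tmap_cls_r g v : mdiff (M := V) (N := M) (fun w => cls rho g w) v /\
  forall w, tmap (M := V) (N := M) (fun w => cls rho g w) v w =
    tmap (assoc_proj S) (g, v) (0, w).
Proof.
have [di ti] := @tmap_id _ _ V v; have [dc tc] := @tmap_cst _ _ _ V G g v.
have [dp tp] := tmap_pair dc di.
have [dq tq] := tmap_comp dp (mdiff_proj (g, v)).
by split=> // w; rewrite (tq w) tp ti tc.
Qed.

Lemma varpi1 v xi w : varpi S 1%g v xi w = tmap (assoc_proj S) (1%g, v) (xi, w).
Proof.
have mul1 : (fun a : G => (1 * a)%g) = id by apply/funext => a; exact: mul1g.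
rewrite /varpi mul1.
by rewrite (@tmap_id _ _ G 1%g).2.
Qed.

Lemma mdiff_rep_orbit v : mdiff (M := K) (N := V) (fun k => rho k v) 1%g.
Proof.
have [di _] := @tmap_id _ _ K 1%g; have [dc _] := @tmap_cst _ _ _ K V v 1%g.
have [dp _] := tmap_pair di dc.
by have [] := tmap_comp dp (smooth_mdiff (rep_smooth rho) (1%g, v)).
Qed.

Lemma mdiff_rep k v : mdiff (M := V) (N := V) (fun w => rho k w) v.
Proof.
have [di _] := @tmap_id _ _ V v; have [dc _] := @tmap_cst _ _ _ V K k v.
have [dp _] := tmap_pair dc di.
by have [] := tmap_comp dp (smooth_mdiff (rep_smooth rho) (k, v)).
Qed.

(* [k . v] and [incl k] become the same point [1, k . v] = [incl k, v]. *)
Lemma tmap_slice_rep_orbit v zeta :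
  tmap (slice_incl S) v (tmap (M := K) (N := V) (fun k => rho k v) 1%g zeta) =
  tmap (M := G) (N := M) (fun a => cls rho a v) 1%g (lie_incl K zeta).
Proof.
have dj : mdiff (slice_incl S) (rho 1%g v) by have [] := tmap_cls_r 1%g (rho 1%g v).
have [_ tj] := tmap_comp (mdiff_rep_orbit v) dj.
have dG : mdiff (M := G) (N := M) (fun a => cls rho a v) (Defs.incl (1%g : K)).
  by have [] := tmap_cls_l (Defs.incl (1%g : K)) v.
have [_ tG] := tmap_comp (smooth_mdiff (incl_smooth K) 1%g) dG.
have jE : slice_incl S \o (fun k : K => rho k v) =
    (fun a : G => cls rho a v) \o @Defs.incl _ _ _ _ K.
  apply/funext => k; rewrite /= /slice_incl.
  by rewrite -(cls_twist k (Defs.incl k)) mulgV.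
by move: (tj zeta) (tG zeta); rewrite jE rep1 incl1 => <- e2; exact: e2.
Qed.

Lemma mdiff_translation a x :
  mdiff (M := prod_manifold G V) (N := prod_manifold G V)
    (fun y => ((a * y.1)%g, y.2)) x.
Proof.
have d1 := @mdiff_fst _ _ _ G V x; have d2 := @mdiff_snd _ _ _ G V x.
have [dc _] := @tmap_cst _ _ _ (prod_manifold G V) G a x.
have [dp _] := tmap_pair dc d1.
have [dm _] := tmap_comp dp (smooth_mdiff (lie_mul_smooth G) (a, x.1)).
by have [] := tmap_pair dm d2.
Qed.

Lemma assoc_act_proj a : assoc_act S a \o assoc_proj S =
  assoc_proj S \o (fun y => ((a * y.1)%g, y.2)).
Proof. by apply/funext => -[g v]; exact: assoc_actE. Qed.

(** Precomposed with the quotient map, the action becomes left translation on [G] followed by the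
    quotient map. Continuity descends by the quotient topology, differentiability by the submersion
    property. *)
Lemma mdiff_assoc_act a x : mdiff (assoc_act S a) (assoc_proj S x).
Proof.
have [dap _] := tmap_comp (mdiff_translation a x)
  (mdiff_proj ((a * x.1)%g, x.2)).
apply: (submersion_descend S_quot); last by rewrite assoc_act_proj.
suff : continuous (assoc_act S a) by apply.
apply/quotient_continuous.
have -> : assoc_act S a \o \pi_(assoc_space rho)%qT =
    assoc_proj S \o (fun y => ((a * y.1)%g, y.2)).
  by rewrite -assoc_act_proj; apply/funext => -[g v].
move=> y; apply: continuous_comp (mdiff_translation a y).1 _.
exact: (mdiff_proj _).1.
Qed.

(** The representative chosen for [[1, v]] is [((incl k)^-1, k . v)] for some [k]. Equivariance
    gives [Y (k . v) = k . Y v], and the actions of [k] and of [(incl k)^-1] cancel. *)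
Lemma E0_slice Y v : equivariant_vf (rep_act rho) Y ->
  E0 Y (slice_incl S v) = tmap (slice_incl S) v (Y v).
Proof.
move=> [_ Y_eq]; rewrite /E0.
case gvE: (assoc_repr (slice_incl S v)) => [g v'].
have [k] : exists k, (g, v') = twist rho k (1%g, v).
  by apply: cls_eq; rewrite -[LHS]cls_repr gvE.
rewrite /twist /= => -[-> ->] {g v' gvE}; rewrite mul1g.
have dj : mdiff (slice_incl S) (rho k v) by have [] := tmap_cls_r 1%g (rho k v).
have [djk tjk] := tmap_comp (mdiff_rep k v) dj.
have [_ ta] := tmap_comp djk (mdiff_assoc_act (Defs.incl k)^-1%g (1%g, rho k v)).
(* This is [(incl k)^-1 . [1, k . w] = [1, w]], to be differentiated at [v]. *)
have aE : assoc_act S (Defs.incl k)^-1%g \o (slice_incl S \o (fun w => rho k w)) =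
    slice_incl S.
  apply/funext => w; rewrite /= /slice_incl assoc_actE mulg1.
  by rewrite -[RHS](cls_twist k) mul1g.
have Yk : Y (rho k v) = tmap (M := V) (N := V) (fun w => rho k w) v (Y v).
  exact: Y_eq.
have := ta (Y v); rewrite aE => e2.
have e1 := f_equal (fun w => tmap (assoc_act S (Defs.incl k)^-1%g)
  (slice_incl S (rho k v)) w) (tjk (Y v)).
rewrite Yk; exact: etrans (esym e1) (esym e2).
Qed.

End AssociatedBundleCalculus.

(* If [w <> 0], moving from [x] by [t (0, w)] changes [F] by o(t), so a correction
   of size o(t) brings us back to the level set of [x], whose second coordinate
   then varies by t|w| + o(t) while its first one varies only by o(t). *)
Lemma vertical_kernel_eq0 (R : realType) (E1 E2 : normedModType R) (N : nat)
    (F : E1 * E2 -> 'rV[R]_N) (x : E1 * E2) (u : 'I_N -> E1 * E2)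
    (r rho C : R) (w : E2) :
  differentiable F x -> 'd F x (0, w) = 0 -> 0 < r ->
  (forall z y, `|z - x| < r -> `|y - F x| < r ->
     exists2 s, `|s| <= 4 * `|y - F z| & F (z + rV_comb u s) = y) ->
  0 < rho -> 0 < C ->
  (forall z, `|z - x| < rho -> F z = F x ->
     `|z.2 - x.2| <= C * `|z.1 - x.1|) ->
  w = 0.
Proof.
move=> dF dFw r0 Fsurj rho0 C0 level; apply: contrapT => /eqP w0.
have norm1 (z : E1 * E2) : `|z.1| <= `|z| by rewrite prod_normE le_max lexx.
have norm2 (z : E1 * E2) : `|z.2| <= `|z|.
  by rewrite prod_normE le_max lexx orbT.
have normw : `|(0 : E1, w)| = `|w|.
  by rewrite prod_normE /= normr0 max_r.
set W := `|w|; have W0 : 0 < W by rewrite normr_gt0.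
pose A : R := 1 + \sum_i `|u i|.
have A0 : 0 < A by rewrite ltr_wpDr ?sumr_ge0.
have uA s : `|rV_comb u s| <= A * `|s|.
  by apply: le_trans (rV_comb_bound _ _) _; rewrite ler_wpM2r// lerDr.
(* Chosen so that [(1 + C) * A * 4 * e = 1 / 2] in the bound on the correction [b]. *)
pose e := (8 * A * (1 + C))^-1.
have C1 : 0 < 1 + C by rewrite addr_gt0.
have e0 : 0 < e by rewrite invr_gt0 !mulr_gt0.
have /nbhs_ballP[del /= del0 delP] := differentiable_estimate dF e0.
pose t := Num.min r (Num.min del rho) / (4 * W).
have t0 : 0 < t by rewrite divr_gt0 ?mulr_gt0// !lt_min r0 del0.
have [tr tdel trho] : [/\ t * W < r, t * W < del & 2 * (t * W) < rho].
  have -> : t * W = Num.min r (Num.min del rho) / 4.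
    by rewrite /t; field; rewrite gt_eqF.
  have minr : Num.min r (Num.min del rho) <= r by rewrite ge_min lexx.
  have mindel : Num.min r (Num.min del rho) <= del.
    by rewrite !ge_min lexx orbT.
  have minrho : Num.min r (Num.min del rho) <= rho.
    by rewrite !ge_min lexx !orbT.
  by split; lra.
pose z := x + t *: (0 : E1, w).
have zx : z - x = t *: (0 : E1, w) by rewrite /z addrC addKr.
have zxn : `|z - x| = t * W by rewrite zx normrZ normw gtr0_norm.
have Fz : `|F x - F z| <= e * (t * W).
  have := delP z; rewrite -ball_normE /= distrC zxn => /(_ tdel).
  by rewrite zx linearZ /= dFw scaler0 subr0 distrC.
have zr : `|z - x| < r by rewrite zxn.
have xr : `|F x - F x| < r by rewrite subrr normr0.
have [s s4 Fs] := Fsurj z (F x) zr xr.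
set b := rV_comb u s in Fs.
have bW : (1 + C) * `|b| <= t * W / 2.
  have h1 := ler_wpM2l (ltW A0) s4.
  have h2 : A * (4 * `|F x - F z|) <= A * (4 * (e * (t * W))).
    by rewrite ler_pM2l// ler_pM2l.
  have := ler_wpM2l (ltW C1) (le_trans (uA s) (le_trans h1 h2)).
  have -> : (1 + C) * (A * (4 * (e * (t * W)))) = t * W / 2.
    by rewrite /e; field; rewrite !gt_eqF.
  by [].
have b_small : `|b| <= t * W.
  have := normr_ge0 b; have := mulr_gt0 t0 W0; move: bW; nra.
have /level : `|z + b - x| < rho.
  rewrite addrAC; apply: le_lt_trans (ler_normD _ _) _; rewrite zxn.
  by lra.
move=> /(_ Fs).
have -> : (z + b).2 - x.2 = t *: w + b.2.
  by rewrite /z /= addrAC [x.2 + _]addrC addrK.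
have -> : (z + b).1 - x.1 = b.1.
  by rewrite /z /= scaler0 addr0 addrC addKr.
(* The right-hand side is at most [(1 + C) * |b|], hence at most [t * W / 2], which contradicts
   [t * W > 0]. *)
move=> h; have : t * W <= `|b.2| + C * `|b.1|.
  have -> : t * W = `|t *: w| by rewrite normrZ gtr0_norm.
  rewrite -[t *: w](addrK b.2); apply: le_trans (ler_normB _ _) _.
  by rewrite addrC lerD2l.
have := norm1 b; have := ler_wpM2l (ltW C0) (norm1 b); have := norm2 b.
have := mulr_gt0 t0 W0; move: bW; lra.
Qed.

(** * Injectivity of the tangent map of the slice inclusion *)

Section SliceImmersion.
Context {R : realType} {n d m N : nat} {G : lieGroup R n} {K : lieSubgroup G d}.
Context {rho : representation K m}.
Variable S : smooth_structure (assoc_space rho) 'rV[R]_N.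
Hypothesis S_quot : is_quotient_structure S.
Hypothesis K_compact : compact [set: K].

Local Notation V := (vs_manifold 'rV[R]_m).
Local Notation M := (Manifold S).
Local Notation chart1 := (chart_at (manifold_struct G) 1%g).

Lemma inclV (k : K) : Defs.incl k^-1%g = (Defs.incl k)^-1%g.
Proof. by apply: (@mulgI _ (Defs.incl k)); rewrite -incl_mul !mulgV incl1. Qed.

(* Compactness makes [incl] an embedding, so that [incl l -> 1] forces [l -> 1];
   the immersion property then turns this into a linear estimate. *)
Lemma rep_orbit_bound v : exists2 C, 0 < C &
  \forall g \near (1%g : G), forall l : K, Defs.incl l = g ->
    `|rho l^-1%g v - v| <= C * `|chart1 g - chart1 1%g|.
Proof.
(* The fibre of the quotient map through [(1, v)] consists of the pairs [((incl k)^-1, k . v)]; with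
   [l = k^-1] these are [(incl l, psi l)]. *)
pose psi : K -> V := fun l => rho l^-1%g v.
have [dc _] := @tmap_cst _ _ _ K V v 1%g.
have [dp _] := tmap_pair (smooth_mdiff (lie_inv_smooth K) 1%g) dc.
have [[_ dpsi] _] := tmap_comp dp (smooth_mdiff (rep_smooth rho) (1^-1%g, v)).
have [C2 C20 psi_bound] := differentiable_lipschitz dpsi.
have [_ dincl] := smooth_mdiff (incl_smooth K) 1%g.
have [C1 C10 incl_bound] := immersion_lower_bound dincl (@incl_immersion _ _ _ _ K 1%g).
exists (C2 * C1); first exact: mulr_gt0.
have W1 : \forall l \near (1%g : K), `|psi l - v| <=
    C2 * C1 * `|chart1 (Defs.incl l) - chart1 1%g|.
  move: (chart_map_cvg psi_bound) (chart_map_cvg incl_bound).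
  apply: filterS2 => l [l_dom /= hpsi] [_ /= hincl].
  move: hpsi hincl.
  rewrite /= !(chart_mapK l_dom) !(@mchart_atK _ _ K) incl1 invg1 rep1.
  by move=> hpsi hincl; apply: le_trans hpsi _; rewrite -mulrA ler_pM2l.
have := compact_injective_near K_compact (@lie_hausdorff _ _ G)
  (incl_smooth K).1 (@incl_inj _ _ _ _ K) W1.
by rewrite incl1; apply: filterS => g Wg l lg; rewrite -lg; exact: Wg.
Qed.

(** A kernel vector [w] gives a vector [(0, w)] killed by the quotient map at [(1, v)]. On the fibre
    through that point [rep_orbit_bound] controls the second coordinate by the first, so
    [vertical_kernel_eq0] applies. *)
Lemma tmap_slice_injective v : injective (tmap (slice_incl S) v).
Proof.
suff ker0 w : tmap (slice_incl S) v w = 0 -> w = 0.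
  by move=> w1 w2 ww; apply/subr0_eq/ker0; rewrite linearB /= ww subrr.
move=> jw0; pose p0 : prod_manifold G V := (1%g, v).
have [u [_ [r r0 Fsurj]]] := submersion_right_inverse p0 S_quot.
have [_ dF] := mdiff_proj S_quot p0.
have dFw : tmap (assoc_proj S) p0 (0, w) = 0.
  by rewrite -(tmap_cls_r S_quot 1%g v).2.
have [C C0 orbit_bound] := rep_orbit_bound v.
(* The first condition turns equal chart values into equal classes; the second is the estimate on
   the fibre. *)
pose good (q : prod_manifold G V) :=
  chart_dom (mchart_at (assoc_proj S p0)) (assoc_proj S q) /\
  forall l : K, Defs.incl l = q.1 ->
    `|rho l^-1%g v - v| <= C * `|chart1 q.1 - chart1 1%g|.
have near_p0 : nbhs p0 good.
  apply: filterI; first exact: (mdiff_proj S_quot p0).1 _ (nbhs_chart_dom _).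
  have c1 := @mdiff_fst _ _ _ G V p0.
  exact: c1.1 _ orbit_bound.
have [rh rh0 rhP] : exists2 rh : R, 0 < rh &
    forall z, `|z - mchart_at p0 p0| < rh ->
    chart_cod (mchart_at p0) z /\ good (chart_inv (mchart_at p0) z).
  have /nbhs_ballP[rh /= rh0 rhP] : \forall z \near mchart_at p0 p0,
      chart_cod (mchart_at p0) z /\ good (chart_inv (mchart_at p0) z).
    by apply: filterI; [exact: chart_cod_near|exact: (chart_inv_cvg near_p0)].
  by exists rh => // z zx; apply: rhP; rewrite -ball_normE /= distrC.
apply: (vertical_kernel_eq0 dF dFw r0 Fsurj rh0 C0) => z zx Fz.
have [[z1 _] [z_dom z_bound]] := rhP z zx.
have piE : assoc_proj S (chart_inv (mchart_at p0) z) = assoc_proj S p0.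
  move: Fz; rewrite /comp mchart_atK => Fz.
  by rewrite -(chart_mapK z_dom) Fz chart_mapK //; exact: chart_at_dom.
have [k [q1 q2]] := cls_eq (esym piE).
have z1K : chart1 (chart_inv (mchart_at p0) z).1 = z.1 by exact: chart_invK z1.
have kq : Defs.incl k^-1%g = (chart_inv (mchart_at p0) z).1.
  by rewrite inclV -[LHS]mul1g; exact: esym q1.
have := z_bound _ kq; rewrite invgK z1K.
have <- : z.2 = rho k v by exact: q2.
by [].
Qed.

End SliceImmersion.

(** * Relative equilibria and velocities on the slice *)

Unset Implicit Arguments.

Theorem theorem4p13 (R : realType) (n d m N : nat)
  (G : lieGroup R n) (K : lieSubgroup G d) (K_compact : compact [set: K])
  (rho : representation K m)
  (S : smooth_structure (assoc_space rho) 'rV[R]_N)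
  (S_quot : is_quotient_structure S)
  (expG : 'rV[R]_n -> G) (expG_exp : is_exp expG)
  (expK : 'rV[R]_d -> K) (expK_exp : is_exp expK)
  (q : {vspace 'rV[R]_n}) (q_split : equivariant_splitting K q)
  (Phi : Manifold S -> 'rV[R]_N -> 'rV[R]_N)
  (Phi_conn : is_connection q Phi)
  (P0 : vector_field (Manifold S) -> vector_field (vs_manifold 'rV[R]_m))
  (P0_spec : is_P0 Phi P0)
  (h : vector_field (Manifold S) -> Manifold S -> 'rV[R]_n)
  (h_spec : is_h q expG P0 h)
  (X : R -> vector_field (Manifold S))
  (X_smooth : smooth_path (assoc_act S) X)
  (X_releq : forall l, rel_equilibrium (assoc_act S) (X l)
                         (slice_incl S 0))
  (I : set R) (gamma : R -> 'rV[R]_m * R) (gamma_curve : is_curve I gamma) :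
  let P0X := fun l => P0 (X l) in
  let j_gamma := fun t => (slice_incl S (gamma t).1, (gamma t).2) in
  (rel_solution_curve (rep_act rho) P0X 0 I gamma <->
   rel_solution_curve (assoc_act S) X (slice_incl S 0) I j_gamma) /\
  (rel_solution_curve (rep_act rho) P0X 0 I gamma ->
   forall t, I t -> forall xi : 'rV[R]_d,
     is_velocity (rep_act rho) expK (P0X (gamma t).2) (gamma t).1 xi <->
     is_velocity (assoc_act S) expG (X (gamma t).2)
       (slice_incl S (gamma t).1)
       (lie_incl K xi + h (X (gamma t).2) (slice_incl S (gamma t).1))).
Proof.
move=> P0X j_gamma.
have X_eq l : equivariant_vf (assoc_act S) (X l) := X_smooth.1 l.
have P0X_eq l : equivariant_vf (rep_act rho) (P0X l) := (P0_spec _ (X_eq l)).1.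
have orbitE v : (fun a => assoc_act S a (slice_incl S v)) = (fun a => cls rho a v).
  by apply/funext => a; rewrite /slice_incl assoc_actE mulg1.
have infM v (xi : 'rV[R]_n) : inf_action (assoc_act S) expG xi (slice_incl S v) =
    tmap (M := G) (N := Manifold S) (fun a => cls rho a v) 1%g xi.
  have dM : mdiff (M := G) (N := Manifold S)
      (fun a => assoc_act S a (slice_incl S v)) 1%g.
    by rewrite orbitE; exact: (tmap_cls_l S_quot 1%g v).1.
  by have := inf_action_orbit xi expG_exp dM; rewrite orbitE.
have infV v (xi : 'rV[R]_d) : inf_action (rep_act rho) expK xi v =
    tmap (M := K) (N := vs_manifold 'rV[R]_m) (fun k => rho k v) 1%g xi.
  exact: inf_action_orbit xi expK_exp (mdiff_rep_orbit v).
have XE l v : X l (slice_incl S v) = tmap (slice_incl S) v (P0X l v) +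
    tmap (M := G) (N := Manifold S) (fun a => cls rho a v) 1%g
      (h (X l) (slice_incl S v)).
  have [_ _ ->] := h_spec _ (X_eq l).
  by rewrite (E0_slice S_quot _ (P0X_eq l)) /partial_gauge infM.
have velE l v (xi : 'rV[R]_d) :
    P0X l v = tmap (M := K) (N := vs_manifold 'rV[R]_m) (fun k => rho k v) 1%g xi <->
    X l (slice_incl S v) = tmap (M := G) (N := Manifold S) (fun a => cls rho a v) 1%g
      (lie_incl K xi + h (X l) (slice_incl S v)).
  (* The orbit direction of [lie_incl K xi] is the image under Tj of that of [xi]; once the [h]
     terms cancel, the converse is the injectivity of Tj. *)
  rewrite XE linearD /= -(tmap_slice_rep_orbit S_quot); split=> [->//|].
  move=> /addIr; exact: tmap_slice_injective.
have releqE l v : rel_equilibrium (rep_act rho) (P0X l) v <->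
    rel_equilibrium (assoc_act S) (X l) (slice_incl S v).
  rewrite /rel_equilibrium /orbit_tangent orbitE.
  split=> [[zeta _ zetaE]|[xi _ xiE]].
    have Xv := (velE l v zeta).1 (esym zetaE).
    by exists (lie_incl K zeta + h (X l) (slice_incl S v)); last exact: esym Xv.
  (* Conversely, if [X] has orbit direction [xi] at [[1, v]], then [Phi] replaces [xi] by its
     projection, which lies in the Lie algebra of [K] and so comes from some [zeta]. *)
  have [_ /(_ v) PX] := P0_spec _ (X_eq l).
  have : splitting_proj K q xi \in subalg K by exact: memv_pi.
  move=> /memv_imgP[zeta _]; rewrite lfunE /= => zetaE.
  have Xvarpi : X l (slice_incl S v) = varpi S 1%g v xi 0.
    by rewrite varpi1; exact: etrans (esym xiE) ((tmap_cls_l S_quot 1%g v).2 xi).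
  rewrite Xvarpi in PX.
  have PhiE : Phi (slice_incl S v) (varpi S 1%g v xi 0) =
      tmap (M := G) (N := Manifold S) (fun a => cls rho a v) 1%g (lie_incl K zeta).
    have := Phi_conn 1%g v xi 0; rewrite zetaE [RHS]varpi1 => PhiE.
    exact: etrans PhiE (esym ((tmap_cls_l S_quot 1%g v).2 _)).
  exists zeta => //; apply: (tmap_slice_injective S_quot K_compact).
  apply: etrans (tmap_slice_rep_orbit S_quot v zeta) _.
  exact: etrans (esym PhiE) (esym PX).
have jc : continuous (slice_incl S).
  by move=> v; exact: (tmap_cls_r S_quot 1%g v).1.1.
split.
  split=> [[eq0 _ g0 eqI]|[_ _ g0 eqI]]; split.
  - by move=> l; apply/releqE.
  - case: gamma_curve => oI iI I0 cg; split=> // t It.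
    have c1 : {for t, continuous (slice_incl S \o (fst \o gamma))}.
      apply: continuous_comp; last exact: jc.
      by apply: continuous_comp; [exact: cg|exact: cvg_fst].
    have c2 : {for t, continuous (snd \o gamma)}.
      by apply: continuous_comp; [exact: cg|exact: cvg_snd].
    exact: cvg_pair c1 c2.
  - by rewrite /j_gamma g0.
  - by move=> t It; apply/releqE; exact: eqI.
  - by move=> l; apply/releqE.
  - exact: gamma_curve.
  - case: g0; rewrite [gamma 0]surjective_pairing /= => g01 ->.
    (* Equality of the classes only gives [(gamma 0).1 = k . 0] for some [k], and this is 0 by
       linearity. *)
    have [k [_ /= gk]] := cls_eq (esym g01); rewrite gk linear0 //.
  - by move=> t It; apply/releqE; exact: eqI.
move=> _ t It xi; rewrite /is_velocity infV infM; exact: velE.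
Qed.
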